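(* For every $n\geq 2$, write $a_r=d_{r+1,r}$ and $b_r=e_{r+1,r}$ for $1\leq r\leq n-1$. Then $A_n^+$ has a presentation with generators $a_1,\ldots,a_{n-1},b_1,\ldots,b_{n-1}$ and the following defining relations: (S1): \[ \begin{aligned} &(a_r,a_s)=1 && (1\leq r<s\leq n-1,\ s-r\geq 2),\\ &(a_r,(a_r,a_{r+1}))=1 && (1\leq r\leq n-2),\\ &((a_r,a_{r+1}),(a_{r+1},a_{r+2}))=1 && (1\leq r\leq n-3),\\ &(b_r,b_s)=1 && (1\leq r<s\leq n-1,\ s-r\geq 2),\\ &(b_r,(b_r,b_{r+1}))=1 && (1\leq r\leq n-2),\\ &((b_r,b_{r+1}),(b_{r+1},b_{r+2}))=1 && (1\leq r\leq n-3); \end{aligned} \] (S2): \[ (a_r,b_s)=1 \qquad (1\leq r,s\leq n-1,\ |r-s|\neq 1); \] (S3): \[ \begin{aligned} &(a_r,a_{r+1})=(a_{r+1}^{-1},b_r) && (1\leq r\leq n-2),\\ &(b_r,b_{r+1})=(b_{r+1}^{-1},a_r) && (1\leq r\leq n-2); \end{aligned} \] (S4): \[ \begin{aligned} &((a_r,a_{r+1}),b_{r+1})=1 && (1\leq r\leq n-2),\\ &((b_r,b_{r+1}),a_{r+1})=1 && (1\leq r\leq n-2). \end{aligned} \]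
   Context: Let $F_n$ be the free group of rank $n\geq 2$ with basis $x_1,\ldots,x_n$. For $1\leq j<i\leq n$, let $d_{i,j},e_{i,j}\in\operatorname{Aut}(F_n)$ be the automorphisms with $d_{i,j}(x_i)=x_ix_j$, $e_{i,j}(x_i)=x_jx_i$, and $d_{i,j}(x_k)=e_{i,j}(x_k)=x_k$ for $k\neq i$. Automorphisms are composed as functions: $(\alpha\beta)(x)=\alpha(\beta(x))$. Set $A_n^+=\langle d_{i,j},e_{i,j}\mid 1\leq j<i\leq n\rangle\leq\operatorname{Aut}(F_n)$. Commutators are $(x,y)=x^{-1}y^{-1}xy$. That a group has a presentation on given elements with given defining relations means that the homomorphism from the abstract group so presented (one abstract generator for each listed element), sending each abstract generator to the corresponding element, is well defined and is an isomorphism. *)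

(* Defs.v *)
(* Groups are the [groupType]s of mathcomp.boot.monoid, which need not be
   finite; [~ x, y] there is x^-1 * y^-1 * x * y. *)
From HB Require Import structures.
From mathcomp Require Import all_boot.
From mathcomp Require Import boolp.

Set Implicit Arguments.
Unset Strict Implicit.
Unset Printing Implicit Defensive.

Local Open Scope group_scope.
Local Open Scope quotient_scope.

Section FreeGroup.
Variable I : choiceType.

(* The letter (i, false) stands for x_i and (i, true) for its inverse. *)
Definition letter := (I * bool)%type.

Definition linv (a : letter) : letter := (a.1, ~~ a.2).

Lemma linvK : involutive linv.
Proof. by case=> i b; rewrite /linv /= negbK. Qed.

Definition reduced (w : seq letter) : bool :=
  sorted (fun a b => b != linv a) w.

Definition push (a : letter) (w : seq letter) : seq letter :=
  if w is b :: w' then if b == linv a then w' else a :: w else [:: a].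

Lemma reduced_push a w : reduced w -> reduced (push a w).
Proof.
case: w => //= b w bw; case: (b =P linv a) => [_|/eqP nba] /=.
  exact: path_sorted bw.
by rewrite nba.
Qed.

Lemma pushK a w : reduced w -> push (linv a) (push a w) = w.
Proof.
case: w => /= [_|b w bw]; first by rewrite linvK eqxx.
case: (b =P linv a) => [eb|/eqP nba] /=; last by rewrite linvK eqxx.
subst b; case: w bw => //= c w; rewrite linvK.
by case: (c =P a).
Qed.

Definition wmul (u v : seq letter) : seq letter := foldr push v u.

Lemma reduced_wmul u v : reduced v -> reduced (wmul u v).
Proof. by move=> rv; elim: u => //= a u IHu; apply: reduced_push. Qed.

Lemma wmul_push a v w : reduced w -> wmul (push a v) w = push a (wmul v w).
Proof.
move=> rw; case: v => //= b v; case: (b =P linv a) => //= ->.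
by rewrite -{1}(linvK a) pushK //; apply: reduced_wmul.
Qed.

Lemma wmulA u v w : reduced w -> wmul u (wmul v w) = wmul (wmul u v) w.
Proof. by move=> rw; elim: u => //= a u ->; rewrite wmul_push. Qed.

Lemma wmulw0 u : reduced u -> wmul u [::] = u.
Proof.
elim: u => //= a u IHu au; rewrite IHu; last exact: path_sorted au.
by case: u au {IHu} => //= b u /andP[/negPf->].
Qed.

Definition winv (u : seq letter) : seq letter := rev (map linv u).

Lemma winvK : involutive winv.
Proof. by move=> u; rewrite /winv map_rev revK mapK //; apply: linvK. Qed.

Lemma reduced_winv u : reduced u -> reduced (winv u).
Proof.
rewrite /reduced /winv rev_sorted sorted_map => ru.
apply: sub_sorted ru => a b /=; rewrite linvK eq_sym.
by rewrite (inv_eq linvK).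
Qed.

Lemma wmulVw u : wmul (winv u) u = [::].
Proof.
rewrite /wmul /winv; elim: u => //= a u IHu.
by rewrite rev_cons foldr_rcons /= linvK eqxx.
Qed.

Record freeg := FreeG { word :> seq letter; _ : reduced word }.

HB.instance Definition _ := [isSub for word].
HB.instance Definition _ := [Choice of freeg by <:].

Lemma wordP (u : freeg) : reduced u. Proof. exact: valP u. Qed.

Definition fg_one : freeg := @FreeG [::] isT.
Definition fg_mul (u v : freeg) : freeg := FreeG (reduced_wmul u (wordP v)).
Definition fg_inv (u : freeg) : freeg := FreeG (reduced_winv (wordP u)).

Fact fg_mulA : associative fg_mul.
Proof. by move=> u v w; apply/val_inj/wmulA/wordP. Qed.

Fact fg_mul1g : left_id fg_one fg_mul.
Proof. by move=> u; apply/val_inj. Qed.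

Fact fg_mulg1 : right_id fg_one fg_mul.
Proof. by move=> u; apply/val_inj/wmulw0/wordP. Qed.

Fact fg_mulVg : left_inverse fg_one fg_inv fg_mul.
Proof. by move=> u; apply/val_inj/wmulVw. Qed.

Fact fg_mulgV : right_inverse fg_one fg_inv fg_mul.
Proof. by move=> u; apply/val_inj; rewrite /= -{1}(winvK u) wmulVw. Qed.

HB.instance Definition _ :=
  isGroup.Build freeg fg_mulA fg_mul1g fg_mulg1 fg_mulVg fg_mulgV.

Definition fgen (i : I) : freeg := @FreeG [:: (i, false)] isT.

Lemma freeg_ind (P : freeg -> Prop) :
  P 1 -> (forall i u, P u -> P (fgen i * u)) ->
  (forall i u, P u -> P ((fgen i)^-1 * u)) -> forall u, P u.
Proof.
move=> P1 Pg PV [w rw]; elim: w rw => [|[i b] w IHw] rw.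
  by congr (P _): P1; apply: val_inj.
have rw' : reduced w by apply: path_sorted rw.
have pw : push (i, b) w = (i, b) :: w.
  by case: w rw {IHw rw'} => //= c w /andP[/negPf->].
case: b rw pw => rw pw.
  by congr (P _): (PV i _ (IHw rw')); apply: val_inj.
by congr (P _): (Pg i _ (IHw rw')); apply: val_inj.
Qed.

Section Lift.
Variables (G : groupType) (f : I -> G).

Definition lift_letter (a : letter) : G := if a.2 then (f a.1)^-1 else f a.1.

(* The homomorphism from the free group that extends f. *)
Definition fg_lift (u : freeg) : G :=
  foldr (fun a g => lift_letter a * g) 1 (word u).

Fact fg_lift_is_multiplicative : {morph fg_lift : u v / u * v}.
Proof.
pose ev (w : seq letter) : G := foldr (fun a g => lift_letter a * g) 1 w.
have evP a w : ev (push a w) = lift_letter a * ev w.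
  case: w => //= b w; case: (b =P linv a) => //= ->; rewrite mulgA.
  by case: a => i [] /=; rewrite /lift_letter /= ?mulVg ?mulgV mul1g.
move=> u v; rewrite /fg_lift /= -!/(ev _).
by elim: (word u) => /= [|a w IHw]; rewrite ?mul1g // evP IHw mulgA.
Qed.

Fact fg_lift1 : fg_lift 1 = 1. Proof. by []. Qed.

HB.instance Definition _ :=
  isMultiplicative.Build freeg G fg_lift fg_lift_is_multiplicative.
HB.instance Definition _ :=
  Multiplicative_isUMagmaMorphism.Build freeg G fg_lift fg_lift1.

Lemma fg_lift_gen i : fg_lift (fgen i) = f i.
Proof. exact: mulg1. Qed.

End Lift.

Lemma fg_morph_eq (G : groupType) (f g : freeg -> G) :
  {morph f : u v / u * v} -> {morph g : u v / u * v} ->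
  (forall i, f (fgen i) = g (fgen i)) -> f =1 g.
Proof.
move=> fM gM fg.
have f1 : f 1 = 1 by apply: (mulgI (f 1)); rewrite -fM !mulg1.
have g1 : g 1 = 1 by apply: (mulgI (g 1)); rewrite -gM !mulg1.
have fV u : f u^-1 = (f u)^-1.
  by apply: (mulgI (f u)); rewrite -fM !mulgV.
have gV u : g u^-1 = (g u)^-1.
  by apply: (mulgI (g u)); rewrite -gM !mulgV.
elim/freeg_ind=> [|i u IHu|i u IHu]; first by rewrite f1.
  by rewrite fM gM fg IHu.
by rewrite fM gM fV gV fg IHu.
Qed.

End FreeGroup.

Section NormalClosure.
Variables (G : groupType) (S : G -> Prop).

Inductive normal_closure : G -> Prop :=
| ncl_in x of S x : normal_closure x
| ncl1 : normal_closure 1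
| nclM x y of normal_closure x & normal_closure y : normal_closure (x * y)
| nclV x of normal_closure x : normal_closure x^-1
| nclJ x y of normal_closure x : normal_closure (x ^ y).

End NormalClosure.

Section PresentedGroup.
Variables (X : choiceType) (R : freeg X -> freeg X -> Prop).

(* [R u v] is the relation u = v, whose relator is u * v^-1. *)
Definition relator (w : freeg X) : Prop := exists u v, R u v /\ w = u * v^-1.

Definition pres_eq : rel (freeg X) :=
  fun u v => `[< normal_closure relator (u * v^-1) >].

Fact pres_eq_refl : reflexive pres_eq.
Proof. by move=> u; apply/asboolP; rewrite mulgV; apply: ncl1. Qed.

Fact pres_eq_sym : symmetric pres_eq.
Proof.
suff H u v : pres_eq u v -> pres_eq v u by move=> u v; apply/idP/idP; apply: H.
by move=> /asboolP/nclV; rewrite invgF => ?; apply/asboolP.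
Qed.

Fact pres_eq_trans : transitive pres_eq.
Proof.
move=> v u w /asboolP uv /asboolP vw; apply/asboolP.
by move: (nclM uv vw); rewrite mulgA mulgVK.
Qed.

Canonical pres_equiv := EquivRel pres_eq pres_eq_refl pres_eq_sym pres_eq_trans.

Definition presented := {eq_quot pres_equiv}.
HB.instance Definition _ := Choice.on presented.
HB.instance Definition _ := EqQuotient.on presented.

Lemma pres_piP u v :
  \pi_presented u = \pi_presented v <-> normal_closure relator (u * v^-1).
Proof.
split=> [/(@eqmodP _ pres_equiv)/asboolP //|uv].
by apply/(@eqmodP _ pres_equiv)/asboolP.
Qed.

Definition pres_one : presented := \pi_presented 1.
Definition pres_mul (x y : presented) : presented := \pi_presented (repr x * repr y).
Definition pres_inv (x : presented) : presented := \pi_presented (repr x)^-1.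

Lemma pres_reprP u : normal_closure relator (repr (\pi_presented u) * u^-1).
Proof. by apply/pres_piP; rewrite reprK. Qed.

Lemma pres_piM u v :
  \pi_presented (u * v) = pres_mul (\pi_presented u) (\pi_presented v).
Proof.
apply/esym/pres_piP; rewrite invgM.
set x := repr (\pi_presented u); set y := repr (\pi_presented v).
have -> : x * y * (v^-1 * u^-1) = (y * v^-1) ^ x^-1 * (x * u^-1).
  by rewrite conjgE invgK !mulgA mulgVK.
exact: nclM (nclJ _ (pres_reprP v)) (pres_reprP u).
Qed.

Lemma pres_piV u : \pi_presented u^-1 = pres_inv (\pi_presented u).
Proof.
apply/pres_piP; rewrite invgK.
set x := repr (\pi_presented u).
have -> : u^-1 * x = (x * u^-1) ^ u by rewrite conjgE !mulgA mulgVK.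
exact: nclJ (pres_reprP u).
Qed.

Fact pres_mulA : associative pres_mul.
Proof.
elim/quotW=> u; elim/quotW=> v; elim/quotW=> w.
by rewrite -(pres_piM v w) -(pres_piM u v) -(pres_piM u _) -(pres_piM _ w) mulgA.
Qed.

Fact pres_mul1g : left_id pres_one pres_mul.
Proof. by elim/quotW=> u; rewrite -pres_piM mul1g. Qed.

Fact pres_mulg1 : right_id pres_one pres_mul.
Proof. by elim/quotW=> u; rewrite -pres_piM mulg1. Qed.

Fact pres_mulVg : left_inverse pres_one pres_inv pres_mul.
Proof. by elim/quotW=> u; rewrite -pres_piV -pres_piM mulVg. Qed.

Fact pres_mulgV : right_inverse pres_one pres_inv pres_mul.
Proof. by elim/quotW=> u; rewrite -pres_piV -pres_piM mulgV. Qed.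

HB.instance Definition _ := isGroup.Build presented
  pres_mulA pres_mul1g pres_mulg1 pres_mulVg pres_mulgV.

Definition pres_gen (x : X) : presented := \pi_presented (fgen x).

Definition has_presentation (G : groupType) (g : X -> G) : Prop :=
  exists phi : {multiplicative presented -> G},
    (forall x, phi (pres_gen x) = g x) /\ bijective phi.

End PresentedGroup.

Section GeneratedSubgroup.
Variables (G : groupType) (S : G -> Prop).

Inductive generated : G -> Prop :=
| gen_in x of S x : generated x
| gen1 : generated 1
| genM x y of generated x & generated y : generated (x * y)
| genV x of generated x : generated x^-1.

Definition gen_pred : pred G := fun x => `[< generated x >].

Record gen_group := GenGroup { gen_val :> G; _ : gen_pred gen_val }.

HB.instance Definition _ := [isSub for gen_val].
HB.instance Definition _ := [Choice of gen_group by <:].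

Fact gen_group_closed : group_closed gen_pred.
Proof.
split=> [|x y /asboolP gx /asboolP gy]; apply/asboolP; first exact: gen1.
by apply: genM gx (genV gy).
Qed.

HB.instance Definition _ :=
  SubChoice_isSubGroup.Build G gen_pred gen_group gen_group_closed.

Definition to_gen (x : G) (Sx : S x) : gen_group :=
  GenGroup (asboolT (gen_in Sx)).

End GeneratedSubgroup.

Section AutomorphismGroup.
Variable G : groupType.

(* The field [aut_inv] is determined by [aut_fun], see [aut_ext]. The product
   of this group is composition of functions, (f * g) x = f (g x). *)
Record aut := Aut {
  aut_fun :> G -> G;
  aut_inv : G -> G;
  autM : {morph aut_fun : x y / x * y};
  autK : cancel aut_fun aut_inv;
  autVK : cancel aut_inv aut_fun
}.

Lemma aut_ext (f g : aut) : f =1 g -> f = g.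
Proof.
case: f g => [f f' fM fK f'K] [g g' gM gK g'K] /= /funext efg.
have efg' : f' = g'.
  by apply/funext=> x; rewrite -[in LHS](g'K x) -efg fK.
by subst g g'; congr Aut; apply: Prop_irrelevance.
Qed.

HB.instance Definition _ := gen_eqMixin aut.
HB.instance Definition _ := gen_choiceMixin aut.

Definition aut_id : aut :=
  @Aut id id (fun _ _ => erefl) (fun _ => erefl) (fun _ => erefl).

Fact aut_compM (f g : aut) : {morph f \o g : x y / x * y}.
Proof. by move=> x y /=; rewrite !autM. Qed.

Definition aut_comp (f g : aut) : aut :=
  Aut (aut_compM f g) (can_comp (@autK f) (@autK g))
    (can_comp (@autVK g) (@autVK f)).

Fact aut_invM (f : aut) : {morph aut_inv f : x y / x * y}.
Proof. by move=> x y; apply: (can_inj (@autK f)); rewrite autM !autVK. Qed.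

Definition aut_inverse (f : aut) : aut :=
  Aut (aut_invM f) (@autVK f) (@autK f).

Fact aut_compA : associative aut_comp.
Proof. by move=> f g h; apply: aut_ext. Qed.

Fact aut_comp1f : left_id aut_id aut_comp.
Proof. by move=> f; apply: aut_ext. Qed.

Fact aut_compf1 : right_id aut_id aut_comp.
Proof. by move=> f; apply: aut_ext. Qed.

Fact aut_compVf : left_inverse aut_id aut_inverse aut_comp.
Proof. by move=> f; apply: aut_ext => x; apply: autK. Qed.

Fact aut_compfV : right_inverse aut_id aut_inverse aut_comp.
Proof. by move=> f; apply: aut_ext => x; apply: autVK. Qed.

HB.instance Definition _ :=
  isGroup.Build aut aut_compA aut_comp1f aut_compf1 aut_compVf aut_compfV.

End AutomorphismGroup.

(* The basis x_1, ..., x_n of F_n is indexed from 0: x_(i+1) is [fgen i] for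
   i : 'I_n. *)
Notation Fn n := (freeg 'I_n).

Section Transvections.
Variables (n : nat) (i j : 'I_n).

(* [d_fun false] maps x_i to x_i x_j and [d_fun true] is its inverse; likewise
   [e_fun false] maps x_i to x_j x_i. *)
Definition xj (b : bool) : Fn n := if b then (fgen j)^-1 else fgen j.

Definition d_fun (b : bool) : Fn n -> Fn n :=
  fg_lift (fun k => if k == i then fgen i * xj b else fgen k).

Definition e_fun (b : bool) : Fn n -> Fn n :=
  fg_lift (fun k => if k == i then xj b * fgen i else fgen k).

Hypothesis ltji : (j < i)%N.

Let neji : (j == i) = false.
Proof. by apply/negbTE; rewrite -val_eqE neq_ltn ltji. Qed.

Fact d_funM b : {morph d_fun b : u v / u * v}. Proof. exact: gmulfM. Qed.
Fact e_funM b : {morph e_fun b : u v / u * v}. Proof. exact: gmulfM. Qed.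

Fact d_funK b : cancel (d_fun b) (d_fun (~~ b)).
Proof.
apply: (@fg_morph_eq _ _ (d_fun (~~ b) \o d_fun b) id) => //= [u v|k].
  by rewrite /= !d_funM.
have dj c : d_fun c (fgen j) = fgen j by rewrite /d_fun fg_lift_gen neji.
have dV c u : d_fun c u^-1 = (d_fun c u)^-1 by rewrite /d_fun gmulfV.
rewrite {2}/d_fun fg_lift_gen; case: eqP => [->|/eqP/negPf nki].
  rewrite d_funM {1}/d_fun fg_lift_gen eqxx -mulgA.
  by case: b; rewrite /xj /= ?dV dj ?mulgV ?mulVg mulg1.
by rewrite /d_fun fg_lift_gen nki.
Qed.

Fact e_funK b : cancel (e_fun b) (e_fun (~~ b)).
Proof.
apply: (@fg_morph_eq _ _ (e_fun (~~ b) \o e_fun b) id) => //= [u v|k].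
  by rewrite /= !e_funM.
have ej c : e_fun c (fgen j) = fgen j by rewrite /e_fun fg_lift_gen neji.
have eV c u : e_fun c u^-1 = (e_fun c u)^-1 by rewrite /e_fun gmulfV.
rewrite {2}/e_fun fg_lift_gen; case: eqP => [->|/eqP/negPf nki].
  rewrite e_funM {2}/e_fun fg_lift_gen eqxx mulgA.
  by case: b; rewrite /xj /= ?eV ej ?mulgV ?mulVg mul1g.
by rewrite /e_fun fg_lift_gen nki.
Qed.

Definition d_ : aut (Fn n) := Aut (d_funM false) (d_funK false) (d_funK true).
Definition e_ : aut (Fn n) := Aut (e_funM false) (e_funK false) (e_funK true).

End Transvections.

Variant de_gens (n : nat) : aut (Fn n) -> Prop :=
| de_d (i j : 'I_n) (ltji : (j < i)%N) : de_gens (d_ ltji)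
| de_e (i j : 'I_n) (ltji : (j < i)%N) : de_gens (e_ ltji).

Definition Aplus (n : nat) := gen_group (@de_gens n).
HB.instance Definition _ n := Group.on (Aplus n).

Section Presentation.
Variable n : nat.
Implicit Types r s t : 'I_n.-1.

Fact ord_top_subproof r : (r.+1 < n)%N.
Proof. by case: n r => [[]|m] //= r; apply: ltn_ord. Qed.

(* With indices counted from 0, a_r is d_(r+1,r) for r = 0, ..., n-2. *)
Definition ord_top r : 'I_n := Ordinal (ord_top_subproof r).
Definition ord_bot r : 'I_n := Ordinal (ltnW (ord_top_subproof r)).

Definition aA r : Aplus n :=
  to_gen (de_d (ltnSn r : (ord_bot r < ord_top r)%N)).
Definition bA r : Aplus n :=
  to_gen (de_e (ltnSn r : (ord_bot r < ord_top r)%N)).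

(* [inl r] is the abstract generator a_r and [inr r] is b_r. *)
Definition abgen : choiceType := ('I_n.-1 + 'I_n.-1)%type.

Definition ab_val (x : abgen) : Aplus n :=
  match x with inl r => aA r | inr r => bA r end.

Definition a_ r : freeg abgen := fgen (inl r : abgen).
Definition b_ r : freeg abgen := fgen (inr r : abgen).

Variant S1 : freeg abgen -> freeg abgen -> Prop :=
| S1a2 r s of (r + 2 <= s)%N : S1 [~ a_ r, a_ s] 1
| S1a3 r s of s = r.+1 :> nat : S1 [~ a_ r, [~ a_ r, a_ s]] 1
| S1a4 r s t of s = r.+1 :> nat & t = s.+1 :> nat :
    S1 [~ [~ a_ r, a_ s], [~ a_ s, a_ t]] 1
| S1b2 r s of (r + 2 <= s)%N : S1 [~ b_ r, b_ s] 1
| S1b3 r s of s = r.+1 :> nat : S1 [~ b_ r, [~ b_ r, b_ s]] 1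
| S1b4 r s t of s = r.+1 :> nat & t = s.+1 :> nat :
    S1 [~ [~ b_ r, b_ s], [~ b_ s, b_ t]] 1.

Variant S2 : freeg abgen -> freeg abgen -> Prop :=
| S2ab r s of s <> r.+1 :> nat & r <> s.+1 :> nat : S2 [~ a_ r, b_ s] 1.

Variant S3 : freeg abgen -> freeg abgen -> Prop :=
| S3a r s of s = r.+1 :> nat : S3 [~ a_ r, a_ s] [~ (a_ s)^-1, b_ r]
| S3b r s of s = r.+1 :> nat : S3 [~ b_ r, b_ s] [~ (b_ s)^-1, a_ r].

Variant S4 : freeg abgen -> freeg abgen -> Prop :=
| S4a r s of s = r.+1 :> nat : S4 [~ [~ a_ r, a_ s], b_ s] 1
| S4b r s of s = r.+1 :> nat : S4 [~ [~ b_ r, b_ s], a_ s] 1.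

Definition ab_rel (u v : freeg abgen) : Prop :=
  [\/ S1 u v, S2 u v, S3 u v | S4 u v].

End Presentation.

(* Main.v *)
Require Import Defs.
From HB Require Import structures.
From mathcomp Require Import all_boot.
From mathcomp Require Import boolp zify.

(** Restricting an automorphism in A_n^+ to the free group on all basis elements
but the last one, x_t, maps A_n^+ onto A_(n-1)^+. The kernel consists of the
maps x_t |-> v^-1 x_t u with u and v in F_(n-1); it is a direct product of two
copies of F_(n-1), so A_n^+ is an iterated extension of such products. The proof
rebuilds this decomposition inside the group P defined by the presentation.

In any group with elements satisfying the relations, the nested commutators
  [~ a_k, [~ a_(k+1), ... [~ a_(m-1), a_m]]]
play the role of the transvections d_(m+1,k), and the nested commutators of the
b's that of the e_(m+1,k). The relations imply the expected behaviour of these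
elements: conjugation by a_r and by b_r, for r < m, acts on them in the same way
as on the transvections ([nested_conj_a], [nested_conj_b], [commute_a_nested],
[commute_b_nested]), and those built from the a's commute
with those built from the b's with the same last index
([commute_nested_nested]). These facts are proved by induction on the length of
the nested commutators, with the help of a second expression
  [~ [~ a_k, a_(k+1)], [~ a_(k+2), ... a_m]]
for them ([nested_shift]).

Consequently the elements of P generated by the a_r and b_r with r <= m have the
form D(u) E(v) h, where D and E are homomorphisms from a free group and h is
generated by the a_r and b_r with r < m ([level_decomposition]). If such an
element acts trivially on F_n then so does h, which is 1 by induction on m, and
what is left is v^-1 x_t u = x_t, which forces u = v = 1 as u and v do not
involve x_t ([trunc_sandwich]). So P acts faithfully ([level_kernel]); every
d_(i,j) and e_(i,j) is the image of a nested commutator, hence P maps onto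
A_n^+. *)

Set Implicit Arguments.
Unset Strict Implicit.
Unset Printing Implicit Defensive.

Local Open Scope group_scope.
Local Open Scope quotient_scope.

(** * Consequences of the relations in an arbitrary group *)

Section CommutatorCalculus.
Variable G : groupType.
Implicit Types x y z t : G.

Lemma commuteR x y z : commute x y -> commute x z -> commute x [~ y, z].
Proof.
move=> xy xz; rewrite /commg /conjg.
by do ![apply: commuteM | apply: commuteV].
Qed.

Lemma commute_conj x y : commute x y -> y ^ x = y.
Proof. by move=> xy; rewrite conjgE -xy mulKg. Qed.

Lemma conj_commute x y : y ^ x = y -> commute x y.
Proof. by move=> yx; rewrite /commute [RHS]conjgC yx. Qed.

Lemma commMg x y z : [~ x * y, z] = [~ x, z] ^ y * [~ y, z].
Proof. by rewrite /commg /conjg !gnorm. Qed.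

Lemma commgM x y z : [~ x, y * z] = [~ x, z] * [~ x, y] ^ z.
Proof. by rewrite /commg /conjg !gnorm. Qed.

Lemma conj_commgr x y : y ^ x = y * [~ x, y]^-1.
Proof. by rewrite /commg /conjg !gnorm. Qed.

Lemma conj_commgl x y : x ^ y = x * [~ x, y].
Proof. by rewrite /commg mulVKg. Qed.

Lemma commVg_commute x y : commute x [~ x, y] -> [~ x^-1, y] = [~ x, y]^-1.
Proof.
move=> xc; rewrite commgEl conjVg conj_commgl invgM invgK mulgA.
by rewrite (commuteV xc) mulgK.
Qed.

(** Comparing the two evaluations of [~ y, z] ^ x, with y ^ x = y * c^-1 and
z ^ x = z, expresses the left-hand side t through [~ c^-1, z]; as c commutes
with t, this can be turned into [~ c, z]. *)
Lemma commg_shift x y z (c := [~ x, y]) :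
    commute x c -> commute x z -> commute c [~ y, z] ->
  [~ x, [~ y, z]] = [~ c, z].
Proof.
move=> xc xz cyz; set t := LHS.
have ct : commute c t by apply: commuteR; first exact: commute_sym.
have tE : t^-1 = [~ c^-1, z].
  apply: (mulgI [~ y, z]); rewrite -conj_commgr conjRg (commute_conj xz).
  rewrite conj_commgr -/c commMg commute_conj //.
  by apply/commute_sym/commuteV/commute_sym.
have cz : c ^ z = c * t.
  apply: invg_inj; rewrite -conjVg conj_commgl -tE -invgM.
  by rewrite ct.
by rewrite commgEl cz mulKg.
Qed.

(** Conjugating z by x * y and by y * x gives t^-1 * z * (t ^ y)^-1 and
t^-1 * z * t^-1, so t ^ y = t. *)
Lemma conj_balance x y z t : commute x y ->
  z ^ x = z * t^-1 -> z ^ y = t^-1 * z -> commute x t -> commute y t.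
Proof.
move=> xy zx zy xt; apply: conj_commute.
have: (z ^ x) ^ y = (z ^ y) ^ x by rewrite -!conjgM xy.
rewrite zx zy !conjMg zx zy !conjVg (commute_conj xt) mulgA.
by move/mulgI/invg_inj.
Qed.

Lemma commg_eq x y z : x * y = y * x * z -> [~ x, y] = z.
Proof. by rewrite commgC => /mulgI. Qed.

End CommutatorCalculus.

Section GroupMorphism.
Variables (G H : groupType) (f : G -> H).
Hypothesis fM : {morph f : x y / x * y}.

Lemma morph1 : f 1 = 1.
Proof. by apply: (mulgI (f 1)); rewrite -fM !mulg1. Qed.

Lemma morphV x : f x^-1 = (f x)^-1.
Proof. by apply: (mulgI (f x)); rewrite -fM !mulgV morph1. Qed.

Lemma morphR x y : f [~ x, y] = [~ f x, f y].
Proof. by rewrite /commg /conjg !fM !morphV. Qed.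

Lemma morphJ x y : f (x ^ y) = f x ^ f y.
Proof. by rewrite /conjg !fM morphV. Qed.

End GroupMorphism.

Section NestedCommutators.
Variables (G : groupType) (a b : nat -> G).

(** The part of the relations that governs the nested commutators of the a's;
exchanging a and b gives the other part. The indices range over all natural
numbers, so that shifting them needs no side condition; a finite family is
extended by 1. *)
Record half_relations : Prop := HalfRelations {
  aa_far r s : r + 2 <= s -> commute (a r) (a s);
  a_aa r : commute (a r) [~ a r, a r.+1];
  aa_aa r : commute [~ a r, a r.+1] [~ a r.+1, a r.+2];
  ab_far r s : s <> r.+1 -> r <> s.+1 -> commute (a r) (b s);
  aa_ab r : [~ a r, a r.+1] = [~ (a r.+1)^-1, b r];
  aa_b r : commute [~ a r, a r.+1] (b r.+1)
}.

(** [nested k j] stands for the transvection d_(i,k) with i = k + j + 1. *)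
Fixpoint nested k j : G := if j is j'.+1 then [~ a k, nested k.+1 j'] else a k.

Lemma nestedS k j : nested k j.+1 = [~ a k, nested k.+1 j].
Proof. by []. Qed.

Lemma commute_nested x k j :
  (forall r, k <= r <= k + j -> commute x (a r)) -> commute x (nested k j).
Proof.
elim: j k => [|j IHj] k xa /=; first by apply: xa; lia.
by apply: commuteR; [apply: xa; lia | apply: IHj => r ?; apply: xa; lia].
Qed.

Hypothesis rel : half_relations.

Lemma commute_a_nested_far r k j : r + 2 <= k -> commute (a r) (nested k j).
Proof.
by move=> rk; apply: commute_nested => s ?; apply: aa_far rel _ _ _; lia.
Qed.

Lemma commute_b_nested_far r k j : r + 2 <= k -> commute (b r) (nested k j).
Proof.
move=> rk; apply: commute_nested => s ?; apply: commute_sym.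
by apply: ab_far rel _ _ _ _; lia.
Qed.

(** In terms of transvections, d_(k+2,k) commutes with d_(i,k+1), and d_(i,k) is
also the commutator of d_(k+2,k) with d_(i,k+2). The first fact implies the
second by [commg_shift], and follows from the second for k + 1: it makes
d_(i,k+1) a commutator of d_(k+3,k+1), which commutes with d_(k+2,k) by [aa_aa],
and of d_(i,k+3), whose entries have large indices. *)
Lemma nested_shift k j :
  commute [~ a k, a k.+1] (nested k.+1 j.+1) /\
  nested k j.+2 = [~ [~ a k, a k.+1], nested k.+2 j].
Proof.
elim: j k => [|j IHj] k.
  split; first exact: (aa_aa rel).
  apply: commg_shift; [exact: (a_aa rel)| |exact: (aa_aa rel)].
  by apply: aa_far rel _ _ _; lia.
have cy : commute [~ a k, a k.+1] (nested k.+1 j.+2).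
  rewrite (IHj k.+1).2; apply: commuteR; first exact: (aa_aa rel).
  apply: commute_sym; apply: commuteR; apply: commute_sym.
    by apply: commute_a_nested_far; lia.
  by apply: commute_a_nested_far; lia.
split=> //; apply: commg_shift (a_aa rel k) _ cy.
by apply: (@commute_a_nested_far k k.+2 j.+1); lia.
Qed.

(** For r = k, the expression of [nested_shift] has only factors commuting with
a_k. For r = k + 1, conjugation by a_(k+1) fixes the inner commutator and
multiplies a_k by c = [~ a_k, a_(k+1)], which commutes with a_k and with the
inner commutator. *)
Lemma commute_a_nested r k j : k <= r < k + j -> commute (a r) (nested k j).
Proof.
elim: j k r => [|j IHj] k r kr; first lia.
have [-> {kr}|[[-> kj]|rk]] : r = k \/ (r = k.+1 /\ 0 < j) \/ k + 2 <= r by lia.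
- case: j {IHj} => [|j]; first exact: (a_aa rel).
  rewrite (nested_shift k j).2; apply: commuteR; first exact: (a_aa rel).
  by apply: commute_a_nested_far; lia.
- case: j kj IHj {kr} => // j _ IHj.
  have [cy _] := nested_shift k j.
  apply: conj_commute; rewrite nestedS conjRg.
  rewrite (commute_conj (IHj _ _ _)); last lia.
  rewrite conj_commgl commMg.
  have -> : [~ [~ a k, a k.+1], nested k.+1 j.+1] = 1 by apply/eqP/commgP.
  rewrite mulg1 commute_conj //; apply: commuteR => //.
  exact/commute_sym/(a_aa rel).
apply: commuteR; last by apply: IHj; lia.
by apply: commute_sym; apply: aa_far rel _ _ _.
Qed.

Lemma nested_conj_a k j :
  nested k.+1 j ^ a k = nested k.+1 j * (nested k j.+1)^-1.
Proof. exact: conj_commgr. Qed.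

(** The relation [aa_ab] is the case j = 0. In general, b_k commutes with all of
[nested k.+1 j] but its first entry a_(k+1). *)
Lemma nested_conj_b k j :
  nested k.+1 j ^ b k = (nested k j.+1)^-1 * nested k.+1 j.
Proof.
have ab : a k.+1 ^ b k = [~ a k, a k.+1]^-1 * a k.+1.
  by rewrite (aa_ab rel) commgEl conjVg invgK invgM invgK mulgVK.
case: j => [|j]; first exact: ab.
rewrite nestedS conjRg ab commMg.
rewrite (commute_conj (commute_b_nested_far _ _)); last lia.
have [cy rE] := nested_shift k j.
rewrite commVg_commute -rE; last first.
  by apply: commuteR cy; apply/commute_sym/(a_aa rel).
by rewrite conjVg commute_conj //; apply: commute_a_nested; lia.
Qed.

(** For r = k, the element z = [nested k.+1 j] has known conjugates under the
commuting a_k and b_k, and [conj_balance] applies. For r = k + 1, b_(k+1) fixes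
the first entry of the commutator of [nested_shift], by [aa_b], and multiplies
the second entry by an element commuting with the first. *)
Lemma commute_b_nested r k j : k <= r <= k + j -> commute (b r) (nested k j).
Proof.
elim: j k r => [|j IHj] k r kr.
  have -> : r = k by lia.
  by apply: commute_sym; apply: ab_far rel _ _ _ _; lia.
have [->|[->|rk]] : r = k \/ r = k.+1 \/ k + 2 <= r by lia.
- apply: conj_balance (nested_conj_a k j) (nested_conj_b k j) _.
    by apply: ab_far rel _ _ _ _; lia.
  by apply: commute_a_nested; lia.
- case: j {IHj kr} => [|j]; first exact/commute_sym/(aa_b rel).
  have [cy rE] := nested_shift k j.
  apply: conj_commute; rewrite rE conjRg nested_conj_b commgM.
  rewrite (commute_conj (commute_sym (aa_b rel _))).
  have -> : [~ [~ a k, a k.+1], (nested k.+1 j.+1)^-1] = 1.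
    by apply/eqP/commgP/commuteV.
  by rewrite conj1g mulg1.
apply: commuteR; last by apply: IHj; lia.
by apply: commute_sym; apply: ab_far rel _ _ _ _; lia.
Qed.

End NestedCommutators.

Lemma commute_nested_nested (G : groupType) (a b : nat -> G) k j l i :
    half_relations a b -> half_relations b a -> k + j = l + i ->
  commute (nested a k j) (nested b l i).
Proof.
move=> relab relba kjli; have [kl|lk] := leqP k l.
  apply: commute_nested => r ?; apply: commute_sym.
  by apply: (commute_b_nested relab); lia.
apply/commute_sym/commute_nested => r ?; apply: commute_sym.
by apply: (commute_b_nested relba); lia.
Qed.

(** * Commutators of transvections *)

Lemma autV (G : groupType) (f : aut G) x : f x^-1 = (f x)^-1.
Proof. exact: morphV (autM f) x. Qed.

Section TransvectionRelations.
Variable n : nat.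
Implicit Types (f g : aut (Fn n)) (i j k l : 'I_n).

Lemma aut_eq_gen f g : (forall k, f (fgen k) = g (fgen k)) -> f = g.
Proof. by move=> fg; apply/aut_ext/fg_morph_eq => //; apply: autM. Qed.

Lemma d_gen i j (ltji : j < i) k :
  d_ ltji (fgen k) = if k == i then fgen i * fgen j else fgen k.
Proof. exact: fg_lift_gen. Qed.

Lemma e_gen i j (ltji : j < i) k :
  e_ ltji (fgen k) = if k == i then fgen j * fgen i else fgen k.
Proof. exact: fg_lift_gen. Qed.

Lemma dV_gen i j (ltji : j < i) k :
  (d_ ltji)^-1 (fgen k) = if k == i then fgen i * (fgen j)^-1 else fgen k.
Proof. exact: fg_lift_gen. Qed.

Lemma eV_gen i j (ltji : j < i) k :
  (e_ ltji)^-1 (fgen k) = if k == i then (fgen j)^-1 * fgen i else fgen k.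
Proof. exact: fg_lift_gen. Qed.

Lemma aut_mulE f g u : (f * g) u = f (g u). Proof. by []. Qed.

(** Evaluates products of automorphisms on a generator, from hypotheses giving
their values on all generators and from equality tests already decided. The
automorphisms are variables when it is called: otherwise unification would
unfold [d_] and [e_] looking for a product or an inverse. *)
Ltac eval_on_generator :=
  repeat first
    [ progress rewrite ?(autM, autV)
    | match goal with H : forall k : 'I_n, aut_fun _ _ = _ |- _ => rewrite H end
    | rewrite (ifT _ _ (eqxx _))
    | match goal with H : (_ == _) = false |- _ => rewrite (ifF _ _ H) end ];
  try done.

Lemma eqF_sym i j : i != j -> (i == j) = false /\ (j == i) = false.
Proof. by move=> /negPf ij; rewrite [j == i]eq_sym ij. Qed.

Lemma neq_eqF i j : i <> j :> nat -> (i == j) = false /\ (j == i) = false.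
Proof. by move=> ij; rewrite [j == i]eq_sym -val_eqE; split; apply/eqP. Qed.

Lemma lt_eqF i j : j < i -> (i == j) = false /\ (j == i) = false.
Proof. by move=> ji; apply: neq_eqF; lia. Qed.

Lemma commute_d_d i j i' j' (ltji : j < i) (ltji' : j' < i') :
    i <> i' :> nat -> j <> i' :> nat -> j' <> i :> nat ->
  commute (d_ ltji) (d_ ltji').
Proof.
move=> /neq_eqF[? ?] /neq_eqF[? ?] /neq_eqF[? ?]; apply: aut_eq_gen => k.
move: (d_gen ltji) (d_gen ltji'); rewrite !aut_mulE.
move: (d_ ltji) (d_ ltji') => f g ? ?.
case: (k =P i) => [->|/eqP/eqF_sym[? ?]]; first by eval_on_generator.
by case: (k =P i') => [->|/eqP/eqF_sym[? ?]]; eval_on_generator.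
Qed.

Lemma commute_e_e i j i' j' (ltji : j < i) (ltji' : j' < i') :
    i <> i' :> nat -> j <> i' :> nat -> j' <> i :> nat ->
  commute (e_ ltji) (e_ ltji').
Proof.
move=> /neq_eqF[? ?] /neq_eqF[? ?] /neq_eqF[? ?]; apply: aut_eq_gen => k.
move: (e_gen ltji) (e_gen ltji'); rewrite !aut_mulE.
move: (e_ ltji) (e_ ltji') => f g ? ?.
case: (k =P i) => [->|/eqP/eqF_sym[? ?]]; first by eval_on_generator.
by case: (k =P i') => [->|/eqP/eqF_sym[? ?]]; eval_on_generator.
Qed.

Lemma commute_d_e i j i' j' (ltji : j < i) (ltji' : j' < i') :
  j <> i' :> nat -> j' <> i :> nat -> commute (d_ ltji) (e_ ltji').
Proof.
move=> /neq_eqF[? ?] /neq_eqF[? ?]; apply: aut_eq_gen => k.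
move: (d_gen ltji) (e_gen ltji'); rewrite !aut_mulE.
move: (d_ ltji) (e_ ltji') => f g ? ?.
case: (i =P i') => [?|/eqP/eqF_sym[? ?]].
  subst i'; case: (k =P i) => [->|/eqP/eqF_sym[? ?]]; eval_on_generator.
  by rewrite mulgA.
case: (k =P i) => [->|/eqP/eqF_sym[? ?]]; first by eval_on_generator.
by case: (k =P i') => [->|/eqP/eqF_sym[? ?]]; eval_on_generator.
Qed.

(** The intermediate index occurs as two ordinals of equal value because the
lower index of a_(r+1) and the upper index of a_r are not the same term. *)
Section TransvectionCommutators.
Variables (i k k' j : 'I_n) (ltjk : j < k) (ltki : k' < i) (ltji : j < i).
Hypothesis k'k : k' = k :> nat.

Lemma commg_d_d : [~ d_ ltjk, d_ ltki] = d_ ltji.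
Proof.
have kk := val_inj k'k; subst k'.
have [[? ?] [? ?] [? ?]] := And3 (lt_eqF ltjk) (lt_eqF ltki) (lt_eqF ltji).
apply: commg_eq; apply: aut_eq_gen => l; rewrite !aut_mulE.
move: (d_ _) (d_gen ltjk) (d_ _) (d_gen ltki) => f ? g ?.
move: (d_ _) (d_gen ltji) => h ?.
case: (l =P i) => [->|/eqP/eqF_sym[? ?]].
  by eval_on_generator; rewrite mulgA.
by case: (l =P k) => [->|/eqP/eqF_sym[? ?]]; eval_on_generator.
Qed.

Lemma commg_e_e : [~ e_ ltjk, e_ ltki] = e_ ltji.
Proof.
have kk := val_inj k'k; subst k'.
have [[? ?] [? ?] [? ?]] := And3 (lt_eqF ltjk) (lt_eqF ltki) (lt_eqF ltji).
apply: commg_eq; apply: aut_eq_gen => l; rewrite !aut_mulE.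
move: (e_ _) (e_gen ltjk) (e_ _) (e_gen ltki) => f ? g ?.
move: (e_ _) (e_gen ltji) => h ?.
case: (l =P i) => [->|/eqP/eqF_sym[? ?]].
  by eval_on_generator; rewrite mulgA.
by case: (l =P k) => [->|/eqP/eqF_sym[? ?]]; eval_on_generator.
Qed.

Lemma commg_dV_e : [~ (d_ ltki)^-1, e_ ltjk] = d_ ltji.
Proof.
have kk := val_inj k'k; subst k'.
have [[? ?] [? ?] [? ?]] := And3 (lt_eqF ltjk) (lt_eqF ltki) (lt_eqF ltji).
apply: commg_eq; apply: aut_eq_gen => l; rewrite !aut_mulE.
move: (e_ _) (e_gen ltjk) (_^-1) (dV_gen ltki) => f ? g ?.
move: (d_ _) (d_gen ltji) => h ?.
case: (l =P i) => [->|/eqP/eqF_sym[? ?]].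
  by eval_on_generator; rewrite invgM mulgA mulgVK.
by case: (l =P k) => [->|/eqP/eqF_sym[? ?]]; eval_on_generator.
Qed.

Lemma commg_eV_d : [~ (e_ ltki)^-1, d_ ltjk] = e_ ltji.
Proof.
have kk := val_inj k'k; subst k'.
have [[? ?] [? ?] [? ?]] := And3 (lt_eqF ltjk) (lt_eqF ltki) (lt_eqF ltji).
apply: commg_eq; apply: aut_eq_gen => l; rewrite !aut_mulE.
move: (d_ _) (d_gen ltjk) (_^-1) (eV_gen ltki) => f ? g ?.
move: (e_ _) (e_gen ltji) => h ?.
case: (l =P i) => [->|/eqP/eqF_sym[? ?]].
  by eval_on_generator; rewrite invgM -!mulgA mulVKg.
by case: (l =P k) => [->|/eqP/eqF_sym[? ?]]; eval_on_generator.
Qed.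

End TransvectionCommutators.

End TransvectionRelations.

(** * Free groups and groups given by a presentation *)

Section FreeGroupWords.
Variable I : choiceType.
Implicit Types u v w : freeg I.

(** The reduced word of x_t * w starts with x_t, while that of w * x_t is w
followed by x_t, without cancellation: it starts with a letter of w. *)
Lemma fg_commute_gen t w :
  all (fun x : letter I => x.1 != t) (word w) -> commute (fgen t) w -> w = 1.
Proof.
case: w => [[|x w] xw] /=; first by move=> _ _; apply: val_inj.
move=> /andP[xt wt] /(congr1 (@word I)) /= tw.
have headE s : all (fun y : letter I => y.1 != t) s -> reduced s ->
    foldr (@push I) [:: (t, false)] s = rcons s (t, false).
  elim: s => //= y s IHs /andP[yt st] ys.
  rewrite IHs //; last exact: path_sorted ys.
  case: s ys {IHs st} => [|z s] /=; last by case/andP => /negPf->.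
  rewrite ifF //; apply/eqP => /(congr1 fst) /= ty.
  by rewrite ty eqxx in yt.
move: tw; rewrite -/(foldr _ _ (x :: w)) headE //=; last by rewrite xt.
case: (x =P linv (t, false)) => [xE|_]; first by rewrite xE eqxx in xt.
by case=> xE; rewrite -xE eqxx in xt.
Qed.

Lemma fg_liftM (G : groupType) (f : I -> G) u v :
  fg_lift f (u * v) = fg_lift f u * fg_lift f v.
Proof. exact: gmulfM. Qed.

Lemma fg_liftV (G : groupType) (f : I -> G) u :
  fg_lift f u^-1 = (fg_lift f u)^-1.
Proof. exact: gmulfV. Qed.

Lemma fg_lift_commute (G : groupType) (f : I -> G) x u :
  (forall i, commute x (f i)) -> commute x (fg_lift f u).
Proof.
move=> xf; elim/freeg_ind: u => [|i u IHu|i u IHu].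
- by rewrite gmulf1; apply: commute1.
- by rewrite fg_liftM fg_lift_gen; apply: commuteM.
rewrite fg_liftM fg_liftV fg_lift_gen.
by apply: commuteM => //; apply: commuteV.
Qed.

Lemma word_mul_all (P : pred (letter I)) u v :
  all P (word u) -> all P (word v) -> all P (word (u * v)).
Proof.
move=> Pu Pv /=; elim: (word u) Pu => //= x s IHs /andP[Px /IHs Ps].
case: (wmul s _) Ps => [|y s'] /=; first by rewrite Px.
by case: eqP => _ /=; [case/andP | rewrite Px].
Qed.

End FreeGroupWords.

Section VonDyck.
Variables (X : choiceType) (R : freeg X -> freeg X -> Prop).

Definition pres_pi (u : freeg X) : presented R := \pi_(presented R) u.

Lemma pres_pi_morph : {morph pres_pi : u v / u * v}.
Proof. exact: pres_piM. Qed.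

Lemma pres_rel u v : R u v -> pres_pi u = pres_pi v.
Proof. by move=> uv; apply/pres_piP/ncl_in; exists u, v. Qed.

Lemma pres_generated x :
  generated (fun y => exists i, y = pres_gen R i) x.
Proof.
elim/quotW: x => u; rewrite -/(pres_pi u).
elim/freeg_ind: u => [|i u IHu|i u IHu].
- by rewrite (morph1 pres_pi_morph); apply: gen1.
- by rewrite pres_pi_morph; apply: genM IHu; apply: gen_in; exists i.
rewrite pres_pi_morph (morphV pres_pi_morph); apply: genM IHu.
by apply/genV/gen_in; exists i.
Qed.

Lemma von_dyck (G : groupType) (g : X -> G) :
    (forall u v, R u v -> fg_lift g u = fg_lift g v) ->
  exists phi : {multiplicative presented R -> G},
    forall i, phi (pres_gen R i) = g i.
Proof.
move=> gR; pose phi (x : presented R) := fg_lift g (repr x).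
have phiE u : phi (pres_pi u) = fg_lift g u.
  have: normal_closure (relator R) (repr (pres_pi u) * u^-1).
    exact: pres_reprP.
  have kill w : normal_closure (relator R) w -> fg_lift g w = 1.
    elim=> {w} [w [x [y [xy ->]]]||x y _ IHx _ IHy|x _ IHx|x y _ IHx].
    - by rewrite fg_liftM fg_liftV (gR _ _ xy) mulgV.
    - exact: gmulf1.
    - by rewrite fg_liftM IHx IHy mulg1.
    - by rewrite fg_liftV IHx invg1.
    by rewrite (morphJ (fg_liftM g)) IHx conj1g.
  by move/kill; rewrite fg_liftM fg_liftV => /divg1_eq.
have phiM : {morph phi : x y / x * y}.
  elim/quotW=> u; elim/quotW=> v; rewrite -!/(pres_pi _).
  by rewrite -pres_pi_morph !phiE fg_liftM.
pose mul := isMultiplicative.Build _ _ phi phiM.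
pose Phi : {multiplicative presented R -> G} := HB.pack phi mul.
by exists Phi => i; rewrite -[RHS](fg_lift_gen g); apply: phiE.
Qed.

End VonDyck.

Section Extension.
Variables (G : groupType) (m : nat).
Implicit Types f g : 'I_m -> G.

Definition extend1 f (r : nat) : G := if insub r is Some i then f i else 1.

Lemma extend1_ord f (r : 'I_m) : extend1 f r = f r.
Proof. by rewrite /extend1 valK. Qed.

Lemma extend1_out f r : m <= r -> extend1 f r = 1.
Proof. by move=> mr; rewrite /extend1 insubN // -leqNgt. Qed.

Lemma extend1_half f g :
  (forall r s : 'I_m, r + 2 <= s -> commute (f r) (f s)) ->
  (forall r s : 'I_m, s = r.+1 :> nat -> commute (f r) [~ f r, f s]) ->
  (forall r s t : 'I_m, s = r.+1 :> nat -> t = s.+1 :> nat ->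
     commute [~ f r, f s] [~ f s, f t]) ->
  (forall r s : 'I_m, s <> r.+1 :> nat -> r <> s.+1 :> nat ->
     commute (f r) (g s)) ->
  (forall r s : 'I_m, s = r.+1 :> nat -> [~ f r, f s] = [~ (f s)^-1, g r]) ->
  (forall r s : 'I_m, s = r.+1 :> nat -> commute [~ f r, f s] (g s)) ->
  half_relations (extend1 f) (extend1 g).
Proof.
have inE r : r < m -> exists i : 'I_m, r = i by move=> rm; exists (Ordinal rm).
move=> far one two farg swap top; split.
- move=> r s rs; have [/extend1_out->|sm] := leqP m s; first exact: commute1.
  have [i ri] := inE r ltac:(lia); have [j sj] := inE s sm; subst.
  by rewrite !extend1_ord; apply: far.
- move=> r; have [/extend1_out->|sm] := leqP m r.+1.
    by rewrite commg1; apply: commute1.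
  have [i ri] := inE r ltac:(lia); have [j sj] := inE _ sm.
  by rewrite sj ri !extend1_ord; apply: one; lia.
- move=> r; have [/extend1_out->|tm] := leqP m r.+2.
    by rewrite [X in commute _ X]commg1; apply: commute1.
  have [i ri] := inE r ltac:(lia); have [j sj] := inE r.+1 ltac:(lia).
  have [k tk] := inE _ tm.
  by rewrite tk sj ri !extend1_ord; apply: two; lia.
- move=> r s rs sr; have [/extend1_out->|sm] := leqP m s; first exact: commute1.
  have [/extend1_out->|rm] := leqP m r; first exact/commute_sym/commute1.
  have [i ri] := inE r rm; have [j sj] := inE s sm; subst.
  by rewrite !extend1_ord; apply: farg.
- move=> r; have [out|sm] := leqP m r.+1.
    by rewrite !(extend1_out _ out) invg1 commg1 comm1g.
  have [i ri] := inE r ltac:(lia); have [j sj] := inE _ sm.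
  by rewrite sj ri !extend1_ord; apply: swap; lia.
move=> r; have [out|sm] := leqP m r.+1.
  by rewrite (extend1_out g out); apply: commute1.
have [i ri] := inE r ltac:(lia); have [j sj] := inE _ sm.
by rewrite sj ri !extend1_ord; apply: top; lia.
Qed.

End Extension.

(** * Layers of the group and faithfulness of its action *)

Section Faithful.
Variables (G : groupType) (a b : nat -> G) (n : nat) (rho : G -> aut (Fn n)).
Hypotheses (relab : half_relations a b) (relba : half_relations b a).
Hypothesis rhoM : {morph rho : x y / x * y}.
Hypothesis rho_a : forall (i j : 'I_n) (ltji : j < i),
  i = j.+1 :> nat -> rho (a j) = d_ ltji.
Hypothesis rho_b : forall (i j : 'I_n) (ltji : j < i),
  i = j.+1 :> nat -> rho (b j) = e_ ltji.

Lemma rho_nested_a l (i k : 'I_n) (ltki : k < i) :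
  i = k + l.+1 :> nat -> rho (nested a k l) = d_ ltki.
Proof.
elim: l k ltki => [|l IHl] k ltki ikl; first by apply: rho_a; lia.
have lt1n : k.+1 < n by have := ltn_ord i; lia.
have lt1i : Ordinal lt1n < i by rewrite /=; lia.
rewrite nestedS (morphR rhoM) (rho_a (ltnSn k : k < Ordinal lt1n)) //.
by rewrite (IHl (Ordinal lt1n) lt1i) /=; [apply: commg_d_d | lia].
Qed.

Lemma rho_nested_b l (i k : 'I_n) (ltki : k < i) :
  i = k + l.+1 :> nat -> rho (nested b k l) = e_ ltki.
Proof.
elim: l k ltki => [|l IHl] k ltki ikl; first by apply: rho_b; lia.
have lt1n : k.+1 < n by have := ltn_ord i; lia.
have lt1i : Ordinal lt1n < i by rewrite /=; lia.
rewrite nestedS (morphR rhoM) (rho_b (ltnSn k : k < Ordinal lt1n)) //.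
by rewrite (IHl (Ordinal lt1n) lt1i) /=; [apply: commg_e_e | lia].
Qed.

Definition level m :=
  generated (fun x => exists2 r, r < m & x = a r \/ x = b r).

(** The generators of index r < m move only the basis element x_(r+1). *)
Lemma level_fix m h (k : 'I_n) : m <= n.-1 -> level m h -> m < k ->
  rho h (fgen k) = fgen k.
Proof.
move=> mn hm mk; elim: hm => {h} [x [r rm xr]||x y _ IHx _ IHy|x _ IHx].
- have rn : r.+1 < n by lia.
  have r1n := ltnW rn.
  have ltr : Ordinal r1n < Ordinal rn by [].
  have [_ kr] : (Ordinal rn == k) = false /\ (k == Ordinal rn) = false.
    by apply: neq_eqF => /=; lia.
  case: xr => ->; first by rewrite (rho_a ltr) // d_gen kr.
  by rewrite (rho_b ltr) // e_gen kr.
- by rewrite (morph1 rhoM).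
- by rewrite rhoM aut_mulE IHy IHx.
by rewrite (morphV rhoM) -[in LHS]IHx; apply: autK.
Qed.

(** Here x_t is the last basis element that is moved, and t - 1 is the largest
index of the generators involved. *)
Section TopLayer.
Variable t : 'I_n.

(** The retraction onto the free group on x_0, ..., x_(t-1). It allows the layer
of x_t to be parametrised by the fixed group F_n instead of that free group. *)
Definition trunc : Fn n -> Fn n :=
  fg_lift (fun k : 'I_n => if k < t then fgen k else 1).

Definition right_factor : Fn n -> G :=
  fg_lift (fun k : 'I_n => if k < t then nested a k (t - k.+1) else 1).

(** The inverse is there because e_(t,k) is x_t |-> v^-1 x_t for v = x_k^-1, and
it is this map, not x_t |-> v x_t, that depends homomorphically on v. *)
Definition left_factor : Fn n -> G :=
  fg_lift (fun k : 'I_n => if k < t then (nested b k (t - k.+1))^-1 else 1).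

Lemma truncM : {morph trunc : u v / u * v}. Proof. exact: fg_liftM. Qed.

Lemma right_factorM : {morph right_factor : u v / u * v}.
Proof. exact: fg_liftM. Qed.

Lemma left_factorM : {morph left_factor : u v / u * v}.
Proof. exact: fg_liftM. Qed.

Lemma commute_right_left u v : commute (right_factor u) (left_factor v).
Proof.
apply: fg_lift_commute => k; apply/commute_sym/fg_lift_commute => l.
case: (leqP t k) => kt; first exact/commute_sym/commute1.
case: (leqP t l) => lt; first exact: commute1.
apply/commute_sym/commuteV.
by apply: commute_nested_nested => //; lia.
Qed.

Lemma conj_morph_gen (w : Fn n -> G) x (f : aut (Fn n)) :
    {morph w : u v / u * v} ->
    (forall k, w (fgen k) ^ x = w (f (fgen k))) ->
  forall u, w u ^ x = w (f u).
Proof.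
move=> wM wf; apply: fg_morph_eq => //= u v; first by rewrite wM conjMg.
by rewrite autM wM.
Qed.

Lemma right_factor_conj_a r u : r.+1 < t ->
  right_factor u ^ a r = right_factor ((rho (a r))^-1 u).
Proof.
move=> rt; have rn : r.+1 < n by have := ltn_ord t; lia.
have r1n := ltnW rn; have ltr : Ordinal r1n < Ordinal rn by [].
rewrite (rho_a ltr) //; move: u; apply: (conj_morph_gen right_factorM) => k.
rewrite dV_gen; case: eqP => [->|nkr].
  rewrite /right_factor fg_liftM fg_liftV !fg_lift_gen /= rt ltnW //.
  have -> : t - r.+1 = (t - r.+2).+1 by lia.
  exact: nested_conj_a.
have kr : k <> r.+1 :> nat by move=> kr; apply: nkr; apply: val_inj.
rewrite /right_factor fg_lift_gen; case: ifP => [kt|_]; last exact: conj1g.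
apply: commute_conj; have [rk|kr'] := leqP r.+2 k.
  by apply: (commute_a_nested_far relab); lia.
by apply: (commute_a_nested relab); lia.
Qed.

Lemma right_factor_conj_b r u : r.+1 < t ->
  right_factor u ^ b r = right_factor ((rho (b r))^-1 u).
Proof.
move=> rt; have rn : r.+1 < n by have := ltn_ord t; lia.
have r1n := ltnW rn; have ltr : Ordinal r1n < Ordinal rn by [].
rewrite (rho_b ltr) //; move: u; apply: (conj_morph_gen right_factorM) => k.
rewrite eV_gen; case: eqP => [->|nkr].
  rewrite /right_factor fg_liftM fg_liftV !fg_lift_gen /= rt ltnW //.
  have -> : t - r.+1 = (t - r.+2).+1 by lia.
  exact: (nested_conj_b relab).
have kr : k <> r.+1 :> nat by move=> kr; apply: nkr; apply: val_inj.
rewrite /right_factor fg_lift_gen; case: ifP => [kt|_]; last exact: conj1g.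
apply: commute_conj; have [rk|kr'] := leqP r.+2 k.
  by apply: (commute_b_nested_far relab); lia.
by apply: (commute_b_nested relab); lia.
Qed.

Lemma left_factor_conj_a r u : r.+1 < t ->
  left_factor u ^ a r = left_factor ((rho (a r))^-1 u).
Proof.
move=> rt; have rn : r.+1 < n by have := ltn_ord t; lia.
have r1n := ltnW rn; have ltr : Ordinal r1n < Ordinal rn by [].
rewrite (rho_a ltr) //; move: u; apply: (conj_morph_gen left_factorM) => k.
rewrite dV_gen; case: eqP => [->|nkr].
  rewrite /left_factor fg_liftM fg_liftV !fg_lift_gen /= rt ltnW //.
  have -> : t - r.+1 = (t - r.+2).+1 by lia.
  by rewrite conjVg (nested_conj_b relba) invgM.
have kr : k <> r.+1 :> nat by move=> kr; apply: nkr; apply: val_inj.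
rewrite /left_factor fg_lift_gen; case: ifP => [kt|_]; last exact: conj1g.
apply/commute_conj/commuteV; have [rk|kr'] := leqP r.+2 k.
  by apply: (commute_b_nested_far relba); lia.
by apply: (commute_b_nested relba); lia.
Qed.

Lemma left_factor_conj_b r u : r.+1 < t ->
  left_factor u ^ b r = left_factor ((rho (b r))^-1 u).
Proof.
move=> rt; have rn : r.+1 < n by have := ltn_ord t; lia.
have r1n := ltnW rn; have ltr : Ordinal r1n < Ordinal rn by [].
rewrite (rho_b ltr) //; move: u; apply: (conj_morph_gen left_factorM) => k.
rewrite eV_gen; case: eqP => [->|nkr].
  rewrite /left_factor fg_liftM fg_liftV !fg_lift_gen /= rt ltnW //.
  have -> : t - r.+1 = (t - r.+2).+1 by lia.
  by rewrite conjVg nested_conj_a invgM.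
have kr : k <> r.+1 :> nat by move=> kr; apply: nkr; apply: val_inj.
rewrite /left_factor fg_lift_gen; case: ifP => [kt|_]; last exact: conj1g.
apply/commute_conj/commuteV; have [rk|kr'] := leqP r.+2 k.
  by apply: (commute_a_nested_far relba); lia.
by apply: (commute_a_nested relba); lia.
Qed.

(** Conjugation by h acts on the right as rho is composed on the left, hence the
inverse of rho h. *)
Lemma conj_level (w : Fn n -> G) :
    (forall r u, r.+1 < t -> w u ^ a r = w ((rho (a r))^-1 u)) ->
    (forall r u, r.+1 < t -> w u ^ b r = w ((rho (b r))^-1 u)) ->
  forall h u, level t.-1 h -> w u ^ h = w ((rho h)^-1 u).
Proof.
move=> wa wb h u hl; move: h hl u.
apply: generated_ind => [x [r rt [] ->] u||x y _ IHx _ IHy u|x _ IHx u].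
- by apply: wa; lia.
- by apply: wb; lia.
- by move=> u; rewrite conjg1 (morph1 rhoM) invg1.
- by rewrite conjgM IHx IHy rhoM invgM.
apply: (conjg_inj x); rewrite conjgKV IHx.
by congr (w _); rewrite (morphV rhoM) invgK; apply/esym/autK.
Qed.

Lemma right_factor_conj h u : level t.-1 h ->
  right_factor u ^ h = right_factor ((rho h)^-1 u).
Proof.
apply: conj_level => r v; first exact: right_factor_conj_a.
exact: right_factor_conj_b.
Qed.

Lemma left_factor_conj h u : level t.-1 h ->
  left_factor u ^ h = left_factor ((rho h)^-1 u).
Proof.
apply: conj_level => r v; first exact: left_factor_conj_a.
exact: left_factor_conj_b.
Qed.

Lemma right_factor_swap h u : level t.-1 h ->
  h * right_factor u = right_factor (rho h u) * h.
Proof.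
move=> hl; rewrite [RHS]conjgC right_factor_conj //.
by congr (_ * right_factor _); apply/esym/autK.
Qed.

Lemma left_factor_swap h u : level t.-1 h ->
  h * left_factor u = left_factor (rho h u) * h.
Proof.
move=> hl; rewrite [RHS]conjgC left_factor_conj //.
by congr (_ * left_factor _); apply/esym/autK.
Qed.

(** The set of these products is a subgroup, as h can be moved to the right of
the other factors and these commute with each other. *)
Lemma level_decomposition g : level t g -> exists u v h,
  level t.-1 h /\ g = right_factor u * left_factor v * h.
Proof.
move: g; apply: generated_ind
  => [x [r rt xr]||x y _ [u [v [h [hl ->]]]] _ [u' [v' [h' [hl' ->]]]]
     |x _ [u [v [h [hl ->]]]]].
- have [rt'|rt'] : r.+1 < t \/ t = r.+1 :> nat by lia.
    exists 1, 1, x; rewrite (morph1 right_factorM) (morph1 left_factorM) !mul1g.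
    split=> //.
    by apply: gen_in; exists r => //; lia.
  have rn : r < n by have := ltn_ord t; lia.
  case: xr => ->.
    exists (fgen (Ordinal rn)), 1, 1; split; first exact: gen1.
    rewrite (morph1 left_factorM) !mulg1 /right_factor fg_lift_gen /= rt rt'.
    by rewrite subnn.
  exists 1, (fgen (Ordinal rn))^-1, 1; split; first exact: gen1.
  rewrite (morph1 right_factorM) mulg1 mul1g (morphV left_factorM).
  by rewrite /left_factor fg_lift_gen /= rt rt' subnn invgK.
- exists 1, 1, 1; split; first exact: gen1.
  by rewrite (morph1 right_factorM) (morph1 left_factorM) !mulg1.
- exists (u * rho h u'), (v * rho h v'), (h * h'); split; first exact: genM.
  rewrite right_factorM left_factorM -!mulgA; congr (_ * _).
  rewrite (mulgA h) (right_factor_swap _ hl) -!mulgA.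
  rewrite (mulgA h) (left_factor_swap _ hl).
  by rewrite (mulgA (left_factor v)) -commute_right_left -!mulgA.
exists (rho h^-1 u^-1), (rho h^-1 v^-1), h^-1; split; first exact: genV.
rewrite -[RHS]mulgA -left_factor_swap; last exact: genV.
rewrite [RHS]mulgA -right_factor_swap; last exact: genV.
rewrite -[RHS]mulgA commute_right_left.
by rewrite (morphV right_factorM) (morphV left_factorM) !invgM.
Qed.

(** Both sides of x_t are recorded at once, which makes the property stable
under products and inverses. *)
Definition acts g (u v : Fn n) := forall k : 'I_n, rho g (fgen k) =
  if k == t then (trunc v)^-1 * fgen t * trunc u else fgen k.

Lemma trunc_fix (f : aut (Fn n)) u :
  (forall k : 'I_n, k < t -> f (fgen k) = fgen k) -> f (trunc u) = trunc u.
Proof.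
move=> ft; move: u; apply: fg_morph_eq => [u v|u v|k].
- by rewrite truncM autM.
- exact: truncM.
rewrite /trunc fg_lift_gen; case: ifP => [/ft //|_].
exact: morph1 (autM f).
Qed.

Lemma acts_fix g u v w : acts g u v -> rho g (trunc w) = trunc w.
Proof. by move=> guv; apply: trunc_fix => k kt; rewrite guv (lt_eqF kt).2. Qed.

Lemma actsM g u v g' u' v' :
  acts g u v -> acts g' u' v' -> acts (g * g') (u * u') (v * v').
Proof.
move=> guv guv' k; rewrite rhoM aut_mulE guv'; case: eqP => [_|/eqP kt].
  rewrite !autM autV !(acts_fix _ guv) guv eqxx !truncM invgM.
  by rewrite !mulgA.
by rewrite guv (negPf kt).
Qed.

Lemma acts1 : acts 1 1 1.
Proof.
move=> k; rewrite (morph1 rhoM) (morph1 truncM) invg1 mulg1 mul1g.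
by case: eqP => [->|].
Qed.

Lemma actsV g u v : acts g u v -> acts g^-1 u^-1 v^-1.
Proof.
move=> guv k; apply: (can_inj (@autK _ (rho g))).
rewrite -[LHS]/((rho g * rho g^-1) (fgen k)) -rhoM mulgV (morph1 rhoM).
case: eqP => [->|/eqP kt]; last by rewrite guv (negPf kt).
rewrite !autM autV !(acts_fix _ guv) guv eqxx !(morphV truncM) invgK.
by rewrite !mulgA mulgV mul1g mulgK.
Qed.

Lemma acts_right_factor u : acts (right_factor u) u 1.
Proof.
have actsx k : acts (right_factor (fgen k)) (fgen k) 1.
  rewrite /acts (morph1 truncM) invg1 /right_factor /trunc !fg_lift_gen.
  case: ifP => [kt|_] l; last first.
    by rewrite (morph1 rhoM) mul1g mulg1; case: eqP => [->|].
  by rewrite (@rho_nested_a _ t k kt) ?d_gen ?mul1g //; lia.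
elim/freeg_ind: u => [|i u IHu|i u IHu].
- by rewrite /right_factor (morph1 (fg_liftM _)); apply: acts1.
- by move: (actsM (actsx i) IHu); rewrite mulg1 /right_factor fg_liftM.
move: (actsM (actsV (actsx i)) IHu).
by rewrite invg1 mulg1 /right_factor fg_liftM fg_liftV.
Qed.

Lemma acts_left_factor u : acts (left_factor u) 1 u.
Proof.
have actsx k : acts (left_factor (fgen k)) 1 (fgen k).
  suff: acts (left_factor (fgen k))^-1 1 (fgen k)^-1.
    by move/actsV; rewrite !invgK invg1.
  rewrite /acts (morph1 truncM) (morphV truncM) invgK.
  rewrite /left_factor /trunc !fg_lift_gen.
  case: ifP => [kt|_] l; last first.
    by rewrite invg1 (morph1 rhoM) mul1g mulg1; case: eqP => [->|].
  by rewrite invgK (@rho_nested_b _ t k kt) ?e_gen ?mulg1 //; lia.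
elim/freeg_ind: u => [|i u IHu|i u IHu].
- by rewrite /left_factor (morph1 (fg_liftM _)); apply: acts1.
- by move: (actsM (actsx i) IHu); rewrite mulg1 /left_factor fg_liftM.
move: (actsM (actsV (actsx i)) IHu).
by rewrite invg1 mulg1 /left_factor fg_liftM fg_liftV.
Qed.

Lemma right_factor_trunc u : right_factor (trunc u) = right_factor u.
Proof.
move: u; apply: fg_morph_eq => [u v|u v|k].
- by rewrite truncM right_factorM.
- exact: right_factorM.
rewrite {1}/trunc fg_lift_gen; case: ifP => // kt.
by rewrite (morph1 right_factorM) /right_factor fg_lift_gen kt.
Qed.

Lemma left_factor_trunc u : left_factor (trunc u) = left_factor u.
Proof.
move: u; apply: fg_morph_eq => [u v|u v|k].
- by rewrite truncM left_factorM.
- exact: left_factorM.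
rewrite {1}/trunc fg_lift_gen; case: ifP => // kt.
by rewrite (morph1 left_factorM) /left_factor fg_lift_gen kt.
Qed.

Lemma trunc_letters u : all (fun x : letter 'I_n => x.1 != t) (word (trunc u)).
Proof.
elim/freeg_ind: u => [|i u IHu|i u IHu] //.
  rewrite truncM; apply: word_mul_all IHu.
  rewrite /trunc fg_lift_gen; case: ifP => //= it.
  by rewrite andbT (lt_eqF it).2.
rewrite truncM (morphV truncM); apply: word_mul_all IHu.
rewrite /trunc fg_lift_gen; case: ifP => //= it.
by rewrite (lt_eqF it).2.
Qed.

Lemma trunc_gen k : trunc (fgen k) = if k < t then fgen k else 1.
Proof. exact: fg_lift_gen. Qed.

Lemma trunc_trunc u : trunc (trunc u) = trunc u.
Proof.
move: u; apply: fg_morph_eq => [u v|u v|k]; try by rewrite !truncM.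
rewrite !trunc_gen; case: ifP => kt; first by rewrite trunc_gen kt.
exact: morph1 truncM.
Qed.

(** Killing x_t in the equation gives trunc u = trunc v, and so this element
commutes with x_t without involving it. *)
Lemma trunc_sandwich u v : (trunc v)^-1 * fgen t * trunc u = fgen t ->
  trunc u = 1 /\ trunc v = 1.
Proof.
move=> vtu; have uv : trunc u = trunc v.
  have := congr1 trunc vtu; rewrite !truncM (morphV truncM) !trunc_trunc.
  rewrite [trunc (fgen t)]fg_lift_gen ltnn mulg1.
  by move/(congr1 (mul (trunc v))); rewrite mulVKg mulg1.
have u1 : trunc u = 1.
  apply: fg_commute_gen (trunc_letters u) _.
  apply: (mulgI (trunc v)^-1); rewrite -uv mulKg mulgA.
  by rewrite -[RHS]vtu uv.
by rewrite -uv.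
Qed.

End TopLayer.

(** The two factors of the top layer fix x_0, ..., x_m, hence so does h when the
product acts trivially; h also fixes the other basis elements, by [level_fix].
So h = 1 by induction, and only the value at x_(m+1) remains to be used. *)
Lemma level_kernel m g : m <= n.-1 -> level m g -> rho g = 1 -> g = 1.
Proof.
elim: m g => [|m IHm] g mn gl.
  move=> _; move: g gl; apply: generated_ind => [x []||x y _ -> _ ->|x _ ->] //.
    exact: mulg1.
  exact: invg1.
have tn : m.+1 < n by lia.
pose t : 'I_n := Ordinal tn.
have [u [v [h [hl ->]]]] := @level_decomposition t g gl.
rewrite rhoM => g1.
have DE := actsM (@acts_right_factor t u) (@acts_left_factor t v).
have fix_k k :
    rho (right_factor t u * left_factor t v) (rho h (fgen k)) = fgen k.
  by rewrite -aut_mulE g1.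
have h1 : h = 1.
  apply: IHm => //; first lia; apply: aut_eq_gen => k.
  have [kt|tk] := ltnP k t; last first.
    by apply: level_fix hl _; rewrite /= in tk *; lia.
  apply: (can_inj (@autK _ (rho (right_factor t u * left_factor t v)))).
  by rewrite fix_k DE (lt_eqF kt).2.
have := fix_k t; rewrite h1 (morph1 rhoM) [X in rho _ X]/(fgen t) DE eqxx.
rewrite mulg1 mul1g => /trunc_sandwich[tu tv].
rewrite -right_factor_trunc -left_factor_trunc tu tv.
by rewrite (morph1 (@right_factorM t)) (morph1 (@left_factorM t)) !mulg1.
Qed.

End Faithful.

(** * The presentation of the group of triangular automorphisms *)

Section Presentation.
Variable n : nat.
Implicit Types r s : 'I_n.-1.

Definition ab_aut (u : freeg (abgen n)) : aut (Fn n) :=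
  gen_val (fg_lift (@ab_val n) u).

Lemma ab_autM : {morph ab_aut : u v / u * v}.
Proof. by move=> u v; rewrite /ab_aut fg_liftM. Qed.

Lemma ab_aut_a r : ab_aut (a_ r) = d_ (ltnSn r : ord_bot r < ord_top r).
Proof. by rewrite /ab_aut fg_lift_gen. Qed.

Lemma ab_aut_b r : ab_aut (b_ r) = e_ (ltnSn r : ord_bot r < ord_top r).
Proof. by rewrite /ab_aut fg_lift_gen. Qed.

(** The inner commutators in the relations are transvections with indices at
distance two, which reduces the commutation relations to those of two
transvections. *)
Lemma ab_aut_commg_aa r s (lt : ord_bot r < ord_top s) : s = r.+1 :> nat ->
  ab_aut [~ a_ r, a_ s] = d_ lt.
Proof.
by move=> sr; rewrite (morphR ab_autM) !ab_aut_a; apply: commg_d_d.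
Qed.

Lemma ab_aut_commg_bb r s (lt : ord_bot r < ord_top s) : s = r.+1 :> nat ->
  ab_aut [~ b_ r, b_ s] = e_ lt.
Proof.
by move=> sr; rewrite (morphR ab_autM) !ab_aut_b; apply: commg_e_e.
Qed.

Lemma ab_aut_rel u v : ab_rel u v -> ab_aut u = ab_aut v.
Proof.
have bot_top r s : s = r.+1 :> nat -> ord_bot r < ord_top s by rewrite /=; lia.
have commE x y : commute (ab_aut x) (ab_aut y) -> ab_aut [~ x, y] = ab_aut 1.
  by move=> xy; rewrite (morphR ab_autM) (morph1 ab_autM); apply/eqP/commgP.
case=> [[r s rs|r s sr|r s t sr ts|r s rs|r s sr|r s t sr ts]
       |[r s sr rs]|[r s sr|r s sr]|[r s sr|r s sr]].
- by apply: commE; rewrite !ab_aut_a; apply: commute_d_d => /=; lia.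
- apply: commE; rewrite (ab_aut_commg_aa (bot_top _ _ sr)) // ab_aut_a.
  by apply: commute_d_d => /=; lia.
- apply: commE; rewrite (ab_aut_commg_aa (bot_top _ _ sr)) //.
  rewrite (ab_aut_commg_aa (bot_top _ _ ts)) //.
  by apply: commute_d_d => /=; lia.
- by apply: commE; rewrite !ab_aut_b; apply: commute_e_e => /=; lia.
- apply: commE; rewrite (ab_aut_commg_bb (bot_top _ _ sr)) // ab_aut_b.
  by apply: commute_e_e => /=; lia.
- apply: commE; rewrite (ab_aut_commg_bb (bot_top _ _ sr)) //.
  rewrite (ab_aut_commg_bb (bot_top _ _ ts)) //.
  by apply: commute_e_e => /=; lia.
- by apply: commE; rewrite ab_aut_a ab_aut_b; apply: commute_d_e => /=; lia.
- rewrite (ab_aut_commg_aa (bot_top _ _ sr)) // (morphR ab_autM).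
  rewrite (morphV ab_autM) ab_aut_a ab_aut_b.
  by apply/esym/commg_dV_e.
- rewrite (ab_aut_commg_bb (bot_top _ _ sr)) // (morphR ab_autM).
  rewrite (morphV ab_autM) ab_aut_a ab_aut_b.
  by apply/esym/commg_eV_d.
- apply: commE; rewrite (ab_aut_commg_aa (bot_top _ _ sr)) // ab_aut_b.
  by apply: commute_d_e => /=; lia.
apply: commE; rewrite (ab_aut_commg_bb (bot_top _ _ sr)) // ab_aut_a.
by apply/commute_sym/commute_d_e => /=; lia.
Qed.

Let P := presented (@ab_rel n).

Definition pres_a : nat -> P := extend1 (fun r => pres_gen (@ab_rel n) (inl r)).
Definition pres_b : nat -> P := extend1 (fun r => pres_gen (@ab_rel n) (inr r)).

Let pi := @pres_pi (abgen n) (@ab_rel n).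
Let piM : {morph pi : u v / u * v} := @pres_pi_morph _ _.

Lemma pi_commute u v : ab_rel [~ u, v] 1 -> commute (pi u) (pi v).
Proof.
move=> uv; apply/commgP/eqP; rewrite -(morphR piM) -(morph1 piM).
exact: pres_rel.
Qed.

Lemma pres_half_ab : half_relations pres_a pres_b.
Proof.
apply: extend1_half => [r s rs|r s sr|r s t sr ts|r s sr rs|r s sr|r s sr];
  rewrite -?/(pi (a_ r)) -?/(pi (a_ s)) -?/(pi (a_ t)) -?/(pi (b_ r))
          -?/(pi (b_ s)) -?(morphV piM) -?(morphR piM).
- by apply/pi_commute/Or41/S1a2.
- by apply/pi_commute/Or41/S1a3.
- by apply/pi_commute/Or41/S1a4.
- by apply/pi_commute/Or42/S2ab.
- by apply/pres_rel/Or43/S3a.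
by apply/pi_commute/Or44/S4a.
Qed.

Lemma pres_half_ba : half_relations pres_b pres_a.
Proof.
apply: extend1_half => [r s rs|r s sr|r s t sr ts|r s sr rs|r s sr|r s sr];
  rewrite -?/(pi (b_ r)) -?/(pi (b_ s)) -?/(pi (b_ t)) -?/(pi (a_ r))
          -?/(pi (a_ s)) -?(morphV piM) -?(morphR piM).
- by apply/pi_commute/Or41/S1b2.
- by apply/pi_commute/Or41/S1b3.
- by apply/pi_commute/Or41/S1b4.
- by apply/commute_sym/pi_commute/Or42/S2ab.
- by apply/pres_rel/Or43/S3b.
by apply/pi_commute/Or44/S4b.
Qed.

Section Map.
Variable phi : {multiplicative P -> Aplus n}.
Hypothesis phi_gen : forall x, phi (pres_gen (@ab_rel n) x) = ab_val x.

Let phi_aut (x : P) : aut (Fn n) := gen_val (phi x).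

Lemma phiM : {morph phi_aut : x y / x * y}.
Proof. by move=> x y; rewrite /phi_aut gmulfM. Qed.

Lemma ord_topE (i j : 'I_n) : i = j.+1 :> nat ->
  exists r : 'I_n.-1, i = ord_top r /\ j = ord_bot r.
Proof.
move=> ij; have jn : j < n.-1 by have := ltn_ord i; lia.
by exists (Ordinal jn); split; apply: val_inj.
Qed.

Lemma phi_a (i j : 'I_n) (ltji : j < i) :
  i = j.+1 :> nat -> phi_aut (pres_a j) = d_ ltji.
Proof.
move=> /ord_topE[r [ir jr]]; subst.
rewrite /phi_aut /pres_a extend1_ord phi_gen /=.
by congr d_; apply: Prop_irrelevance.
Qed.

Lemma phi_b (i j : 'I_n) (ltji : j < i) :
  i = j.+1 :> nat -> phi_aut (pres_b j) = e_ ltji.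
Proof.
move=> /ord_topE[r [ir jr]]; subst.
rewrite /phi_aut /pres_b extend1_ord phi_gen /=.
by congr e_; apply: Prop_irrelevance.
Qed.

Lemma pres_level (x : P) : level pres_a pres_b n.-1 x.
Proof.
move: x (pres_generated x); apply: generated_ind
  => [x [[r|r] ->]||x y _ IHx _|x _].
- by apply: gen_in; exists r => //; left; rewrite /pres_a extend1_ord.
- by apply: gen_in; exists r => //; right; rewrite /pres_b extend1_ord.
- exact: gen1.
- exact: genM.
exact: genV.
Qed.

Lemma phi_inj : injective phi.
Proof.
move=> x y xy; apply: divg1_eq.
apply: (level_kernel pres_half_ab pres_half_ba phiM phi_a phi_b (leqnn _)).
  exact: pres_level.
by rewrite phiM (morphV phiM) /phi_aut xy mulgV.
Qed.

Lemma phi_surj (g : Aplus n) : exists x, phi x = g.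
Proof.
suff [x xg] : exists x, phi_aut x = gen_val g by exists x; apply: val_inj.
case: g => g /= /asboolP; move: g; apply: generated_ind
  => [g [] i j ltji||x y _ [u <-] _ [v <-]|x _ [u <-]].
- exists (nested pres_a j (i - j.+1)).
  by apply: (rho_nested_a phiM phi_a); lia.
- exists (nested pres_b j (i - j.+1)).
  by apply: (rho_nested_b phiM phi_b); lia.
- by exists 1; exact: morph1 phiM.
- by exists (u * v); rewrite phiM.
by exists u^-1; rewrite (morphV phiM).
Qed.

Lemma phi_bij : bijective phi.
Proof.
pose psi g := sval (cid (phi_surj g)).
have psiK g : phi (psi g) = g by rewrite /psi; case: cid.
by exists psi => // x; apply: phi_inj; rewrite psiK.
Qed.

End Map.
End Presentation.

Theorem theorem2 (n : nat) (hn : (2 <= n)%N) :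
  has_presentation (@ab_rel n) (@ab_val n).
Proof.
have [u v uv|phi phi_gen] := von_dyck (g := @ab_val n) (R := @ab_rel n).
  by apply: val_inj; apply: ab_aut_rel.
by exists phi; split=> //; apply: phi_bij phi_gen.
Qed.
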